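(* Let $\mathcal H$ be a real separable Hilbert space with $\dim\mathcal H=\infty$, let $\mathcal N\subset\mathcal H\subset\mathcal N'$ be a Gel'fand triple, and let $\mathcal N_p$, $p\in\mathbb N_0$, be the associated Hilbert spaces (completions of $\mathcal N$ with respect to the defining norms). Define $$s(\mathcal N):=\bigcap_{p\in\mathbb N_0}\ell_p^2(\mathcal N_p),$$ with the topology given by the family of norms of the spaces $\ell_p^2(\mathcal N_p)$, $p\in\mathbb N_0$, and let $s'(\mathcal N)$ be its topological dual. Then $s(\mathcal N)\subset\ell^2(\mathcal H)\subset s'(\mathcal N)$ is a Gel'fand triple.
   Context: Gel'fand triple: Let $\mathcal H$ be a real separable Hilbert space, $\mathcal N$ a real topological vector space and $\mathcal N'$ its topological dual. $\mathcal N\subset\mathcal H\subset\mathcal N'$ is called a Gel'fand triple if the following holds. The topology of $\mathcal N$ is defined by a family of inner products $((\cdot,\cdot)_p)_{p\in\mathbb N_0}$ with norms $(\|\cdot\|_p)_{p\in\mathbb N_0}$ that are compatible: if $p,q\in\mathbb N_0$ and a sequence $(\xi_n)$ in $\mathcal N$ converges to zero with respect to $\|\cdot\|_p$ and is Cauchy with respect to $\|\cdot\|_q$, then $\|\xi_n\|_q\to0$. The norms are increasing, $\|\cdot\|_p\le\|\cdot\|_{p+1}$. $\mathcal N$ is complete with respect to the metric $(\xi,\zeta)\mapsto\sum_{p=0}^\infty2^{-p}\frac{\|\xi-\zeta\|_p}{1+\|\xi-\zeta\|_p}$ (which induces its topology). With $\mathcal N_p$ denoting the Hilbert space completion of $\mathcal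 N$ with respect to $\|\cdot\|_p$, one has $\mathcal N_0=\mathcal H$ (so $\mathcal N\subset\mathcal H$ densely and continuously, and $\mathcal N\subset\dots\subset\mathcal N_2\subset\mathcal N_1\subset\mathcal H$). For each $p\in\mathbb N_0$ the inclusion $\mathcal N_{p+1}\hookrightarrow\mathcal N_p$ is a Hilbert–Schmidt operator. $\mathcal H$ is identified with its dual, giving $\mathcal H=\mathcal H'\subset\mathcal N'$. For $p\in\mathbb Z$ and a Hilbert space $H$, $\ell_p^2(H):=\{f\in H^{\mathbb N}:\sum_{k=1}^\infty k^{2p}\|f_k\|_H^2<\infty\}$, a Hilbert space with inner product $\sum_{k}k^{2p}(f_k,g_k)_H$; $\ell^2(\mathcal H):=\ell_0^2(\mathcal H)$. *)

(* Defs.v *)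
From HB Require Import structures.
From mathcomp Require Import all_boot all_order all_algebra.
From mathcomp Require Import all_classical all_reals all_analysis.
From mathcomp Require Import ring lra.

Set Implicit Arguments.
Unset Strict Implicit.
Unset Printing Implicit Defensive.

Import Order.TTheory GRing.Theory Num.Theory.
Import numFieldNormedType.Exports.

Local Open Scope classical_set_scope.
Local Open Scope ring_scope.

Record is_inner_product (R : realType) (V : lmodType R) (ip : V -> V -> R) :
    Prop := IsInnerProduct {
  ipC : forall x y, ip x y = ip y x ;
  ipDl : forall x y z, ip (x + y) z = ip x z + ip y z ;
  ipZl : forall a x y, ip (a *: x) y = a * ip x y ;
  ip_ge0 : forall x, 0 <= ip x x ;
  ip_eq0 : forall x, ip x x = 0 -> x = 0 }.

Definition ip_norm (R : realType) (V : lmodType R) (ip : V -> V -> R) (x : V) : R :=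
  Num.sqrt (ip x x).

Section InnerProductTheory.
Context (R : realType) (V : lmodType R) (ip : V -> V -> R).
Hypothesis ipP : is_inner_product ip.

Lemma ipDr x y z : ip z (x + y) = ip z x + ip z y.
Proof. by rewrite (ipC ipP) (ipDl ipP) !(ipC ipP z). Qed.

Lemma ipZr a x y : ip y (a *: x) = a * ip y x.
Proof. by rewrite (ipC ipP) (ipZl ipP) (ipC ipP y). Qed.

Lemma ip0l x : ip 0 x = 0.
Proof. by rewrite -(scale0r (0 : V)) (ipZl ipP) mul0r. Qed.

Lemma ip_norm_ge0 x : 0 <= ip_norm ip x.
Proof. exact: sqrtr_ge0. Qed.

Lemma ip_norm_sqr x : ip_norm ip x ^+ 2 = ip x x.
Proof. by rewrite sqr_sqrtr// (ip_ge0 ipP). Qed.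

Lemma ip_norm0 : ip_norm ip 0 = 0.
Proof. by rewrite /ip_norm ip0l sqrtr0. Qed.

Lemma ip_norm_eq0 x : ip_norm ip x = 0 -> x = 0.
Proof.
by move=> x0; apply: (ip_eq0 ipP); rewrite -ip_norm_sqr x0 expr0n.
Qed.

Lemma ip_normZ a x : ip_norm ip (a *: x) = `|a| * ip_norm ip x.
Proof.
rewrite /ip_norm (ipZl ipP) ipZr mulrA -expr2 sqrtrM ?sqr_ge0//.
by rewrite sqrtr_sqr.
Qed.

Lemma ip_le_norm x y : ip x y <= ip_norm ip x * ip_norm ip y.
Proof.
have [/eqP x0|x0] := boolP (ip_norm ip x == 0).
  by rewrite x0 mul0r (ip_norm_eq0 x0) ip0l.
have [/eqP y0|y0] := boolP (ip_norm ip y == 0).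
  by rewrite y0 mulr0 (ip_norm_eq0 y0) (ipC ipP) ip0l.
set a := ip_norm ip x in x0 *; set b := ip_norm ip y in y0 *.
have a0 : 0 < a by rewrite lt0r x0 ip_norm_ge0.
have b0 : 0 < b by rewrite lt0r y0 ip_norm_ge0.
have := ip_ge0 ipP (b *: x + (- a) *: y).
rewrite (ipDl ipP) !ipDr !(ipZl ipP) !ipZr (ipC ipP y x).
rewrite -(ip_norm_sqr x) -(ip_norm_sqr y) -/a -/b => h.
have ab0 : 0 < a * b by rewrite mulr_gt0.
rewrite -subr_ge0 -(pmulr_rge0 _ ab0).
have : 0 <= 2 * (a * b * (a * b - ip x y)).
  by apply: le_trans h _; rewrite le_eqVlt; apply/orP; left; apply/eqP; ring.
by move=> {}h; lra.
Qed.

Lemma ip_normD x y : ip_norm ip (x + y) <= ip_norm ip x + ip_norm ip y.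
Proof.
rewrite -[leRHS]ger0_norm ?addr_ge0 ?ip_norm_ge0// -sqrtr_sqr.
rewrite {1}/ip_norm ler_sqrt ?sqr_ge0//.
rewrite (ipDl ipP) !ipDr (ipC ipP y x) sqrrD !ip_norm_sqr.
have := ip_le_norm x y; lra.
Qed.

End InnerProductTheory.

HB.mixin Record CompleteNormedModule_isHilbert (R : realType) V
    & CompleteNormedModule R V := {
  hdot : V -> V -> R ;
  hdot_ip : is_inner_product hdot ;
  hdot_norm : forall x : V, `|x| = ip_norm hdot x }.

#[short(type="hilbertType")]
HB.structure Definition Hilbert (R : realType) :=
  {V of CompleteNormedModule_isHilbert R V & CompleteNormedModule R V}.

(* Sequences are mathematically indexed by k >= 1: coordinate k of f : nat -> K
   stands for f_(k+1), hence the weight (k + 1) ^ (2 p). *)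
Definition ell2_weight (R : realType) (p : int) (k : nat) : R :=
  (k.+1%:R : R) ^ (p *+ 2).

Definition ell2_pred (R : realType) (K : hilbertType R) (p : int) :
    {pred nat -> K} :=
  mem [set f : nat -> K | cvgn (series (fun k => ell2_weight R p k * `|f k| ^+ 2))].
Arguments ell2_pred {R} K p _.

Record ell2 (R : realType) (p : int) (K : hilbertType R) := Ell2 {
  ell2_seq :> nat -> K ;
  ell2_mem : ell2_seq \in ell2_pred K p }.

Section Ell2.
Context (R : realType) (K : hilbertType R) (p : int).
Implicit Types f g : nat -> K.

Local Notation w := (ell2_weight R p).

Lemma ell2_weight_gt0 k : 0 < w k.
Proof. by rewrite /ell2_weight exprz_gt0// ltr0n. Qed.

Lemma ell2_term_ge0 f k : 0 <= w k * `|f k| ^+ 2.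
Proof. by rewrite mulr_ge0 ?sqr_ge0// ltW// ell2_weight_gt0. Qed.

Lemma ell2_predP f : reflect
  (exists M, forall n, series (fun k => w k * `|f k| ^+ 2) n <= M)
  (f \in ell2_pred K p).
Proof.
have nd : nondecreasing_seq (series (fun k => w k * `|f k| ^+ 2)).
  by apply: nondecreasing_series => k _ _; exact: ell2_term_ge0.
apply: (iffP idP) => [|[M fM]]; rewrite inE/=.
  move=> cf; exists (limn (series (fun k => w k * `|f k| ^+ 2))) => n.
  exact: nondecreasing_cvgn_le.
by apply: nondecreasing_is_cvgn => //; exists M => _ [n _ <-].
Qed.

Lemma ell2_submod_closed : submod_closed (ell2_pred K p).
Proof.
split.
  apply/ell2_predP; exists 0 => n; rewrite /series/= big1// => k _.
  by rewrite normr0 expr0n mulr0.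
move=> a f g /ell2_predP[M fM] /ell2_predP[M' gM].
apply/ell2_predP; exists (2 * `|a| ^+ 2 * M + 2 * M') => n.
apply: (@le_trans _ _ (2 * `|a| ^+ 2 * series (fun k => w k * `|f k| ^+ 2) n +
    2 * series (fun k => w k * `|g k| ^+ 2) n)); last first.
  have a2 := sqr_ge0 `|a|.
  by rewrite lerD// ler_wpM2l// ?mulr_ge0//; lra.
rewrite /series/= !mulr_sumr -big_split/=; apply: ler_sum => k _.
rewrite (_ : _ + _ = w k * (2 * (`|a| * `|f k|) ^+ 2 + 2 * `|g k| ^+ 2)); last first.
  by rewrite exprMn; ring.
rewrite ler_pM2l ?ell2_weight_gt0// -normrZ.
apply: (@le_trans _ _ ((`|a *: f k| + `|g k|) ^+ 2)).
  by rewrite ler_sqr ?nnegrE ?addr_ge0// ler_normD.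
rewrite -subr_ge0 (_ : _ - _ = (`|a *: f k| - `|g k|) ^+ 2) ?sqr_ge0//; ring.
Qed.

HB.instance Definition _ :=
  GRing.isSubmodClosed.Build R (nat -> K) (ell2_pred K p) ell2_submod_closed.

HB.instance Definition _ := [isSub for @ell2_seq R p K].
HB.instance Definition _ := [Choice of ell2 p K by <:].
HB.instance Definition _ := [SubChoice_isSubLmodule of ell2 p K by <:].

Definition ell2_dot (f g : ell2 p K) : R :=
  limn (series (fun k => w k * hdot (f k) (g k))).

Lemma ell20 k : (0 : ell2 p K) k = 0.
Proof. by rewrite -[LHS]/(val (0 : ell2 p K) k) raddf0. Qed.

Lemma ell2D (f g : ell2 p K) k : (f + g) k = f k + g k.
Proof. by rewrite -[(f + g) k]/(val (f + g) k) raddfD. Qed.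

Lemma ell2Z a (f : ell2 p K) k : (a *: f) k = a *: f k.
Proof. by rewrite -[(a *: f) k]/(val (a *: f) k) linearZ. Qed.

Lemma ell2B (f g : ell2 p K) k : (f - g) k = f k - g k.
Proof. by rewrite -[(f - g) k]/(val (f - g) k) raddfB. Qed.

Lemma hdotxx (x : K) : hdot x x = `|x| ^+ 2.
Proof. by rewrite hdot_norm ip_norm_sqr//; exact: hdot_ip. Qed.

Lemma hdot_le (x y : K) : `|hdot x y| <= `|x| * `|y|.
Proof.
have ipP := @hdot_ip R K.
rewrite ler_norml; apply/andP; split; last by rewrite !hdot_norm ip_le_norm.
rewrite lerNl -mulN1r -(ipZl ipP) scaleN1r -(normrN x).
by rewrite !hdot_norm ip_le_norm.
Qed.

Lemma is_cvg_ell2_dot (f g : ell2 p K) :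
  cvgn (series (fun k => w k * hdot (f k) (g k))).
Proof.
apply: normed_cvg.
have /ell2_predP[M fM] := ell2_mem f; have /ell2_predP[M' gM] := ell2_mem g.
apply: nondecreasing_is_cvgn; first by apply: nondecreasing_series => k _ _; exact: normr_ge0.
exists (M + M') => _ [n _ <-]; apply: le_trans (lerD (fM n) (gM n)).
rewrite /series/= -big_split/=; apply: ler_sum => k _.
rewrite normrM (gtr0_norm (ell2_weight_gt0 k)) -mulrDr.
rewrite ler_pM2l ?ell2_weight_gt0//; apply: le_trans (hdot_le _ _) _.
have := sqr_ge0 (`|f k| - `|g k|); have := sqr_ge0 (`|f k| + `|g k|).
by rewrite sqrrB sqrrD; lra.
Qed.

Lemma ell2_dotxx_ge (f : ell2 p K) n :
  series (fun k => w k * `|f k| ^+ 2) n <= ell2_dot f f.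
Proof.
rewrite /ell2_dot (_ : (fun k => w k * hdot _ _) = fun k => w k * `|f k| ^+ 2).
  apply: nondecreasing_cvgn_le; last by have := ell2_mem f; rewrite inE.
  by apply: nondecreasing_series => k _ _; exact: ell2_term_ge0.
by apply/funext => k; rewrite hdotxx.
Qed.

Lemma ell2_dotxx_le (f : ell2 p K) M :
  (forall n, series (fun k => w k * `|f k| ^+ 2) n <= M) -> ell2_dot f f <= M.
Proof.
move=> fM; apply: limr_le; first exact: is_cvg_ell2_dot.
apply: nearW => n; rewrite (_ : (fun k => w k * hdot _ _) =
  fun k => w k * `|f k| ^+ 2)//.
by apply/funext => k; rewrite hdotxx.
Qed.

Lemma ell2_dot_ip : is_inner_product ell2_dot.
Proof.
have ipP := @hdot_ip R K; split.
- move=> f g; congr (limn (series _)); apply/funext => k.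
  by rewrite (ipC ipP).
- move=> f g h; rewrite /ell2_dot -lim_seriesD; [|exact: is_cvg_ell2_dot..].
  congr (limn (series _)); apply/funext => k.
  by rewrite ell2D (ipDl ipP) mulrDr.
- move=> a f g; rewrite /ell2_dot.
  rewrite -[a * _]/(a *: _) -lim_seriesZ; last exact: is_cvg_ell2_dot.
  congr (limn (series _)); apply/funext => k.
  by rewrite ell2Z (ipZl ipP) mulrCA.
- move=> f; apply: le_trans (ell2_dotxx_ge f 0%N).
  by rewrite /series/= big_geq.
- move=> f f0; apply/val_inj/funext => k /=.
  have := ell2_dotxx_ge f k.+1; rewrite f0 /series/= big_nat_recr//= => h.
  have s0 : 0 <= \sum_(0 <= i < k) w i * `|f i| ^+ 2.
    by apply: sumr_ge0 => i _; exact: ell2_term_ge0.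
  have : w k * `|f k| ^+ 2 == 0.
    by rewrite eq_le ell2_term_ge0 andbT; lra.
  by rewrite mulf_eq0 gt_eqF ?ell2_weight_gt0//= expf_eq0/= normr_eq0 => /eqP.
Qed.

HB.instance Definition _ := Lmodule_isNormed.Build R (ell2 p K)
  (ip_normD ell2_dot_ip) (ip_normZ ell2_dot_ip) (ip_norm_eq0 ell2_dot_ip).

Lemma ell2_norm_ge (f : ell2 p K) n :
  series (fun k => w k * `|f k| ^+ 2) n <= `|f| ^+ 2.
Proof.
rewrite -[`|f|]/(ip_norm ell2_dot f) (ip_norm_sqr ell2_dot_ip).
exact: ell2_dotxx_ge.
Qed.

Lemma ell2_norm_coord (f : ell2 p K) k : w k * `|f k| ^+ 2 <= `|f| ^+ 2.
Proof.
apply: le_trans (ell2_norm_ge f k.+1); rewrite /series/= big_nat_recr//= lerDr.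
by apply: sumr_ge0 => i _; exact: ell2_term_ge0.
Qed.

Lemma ell2_complete (F : set_system (ell2 p K)) :
  ProperFilter F -> cauchy F -> cvg F.
Proof.
move=> FF Fc.
have Fc' (e : R) : 0 < e ->
    exists f0 : ell2 p K, \forall f \near F, `|f0 - f| < e.
  by move=> e0; have /cauchyP/(_ e e0)[f0 ?] := Fc; exists f0.
have coordc k : cvg ((fun f : ell2 p K => f k) @ F).
  apply/cauchy_cvgP/cauchyP => e e0.
  pose c := Num.sqrt (w k).
  have c0 : 0 < c by rewrite sqrtr_gt0 ell2_weight_gt0.
  have [f0 Ff0] := Fc' (c * e) (mulr_gt0 c0 e0).
  exists (f0 k); rewrite /= nbhs_simpl; near=> f; rewrite -ball_normE/=.
  have : `|f0 - f| < c * e by near: f.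
  rewrite -ell2B => h.
  have := ell2_norm_coord (f0 - f) k; rewrite -(sqr_sqrtr (ltW (ell2_weight_gt0 k))).
  rewrite -exprMn ler_sqr ?nnegrE ?mulr_ge0 ?sqrtr_ge0// -/c => /le_lt_trans/(_ h).
  by rewrite ltr_pM2l.
pose g k : K := lim ((fun f : ell2 p K => f k) @ F).
have key (e : R) : 0 < e -> exists f0 : ell2 p K, (\forall f \near F, `|f0 - f| < e) /\
    forall n, series (fun k => w k * `|f0 k - g k| ^+ 2) n <= e ^+ 2.
  move=> e0; have [f0 Ff0] := Fc' e e0; exists f0; split => // n.
  have cv : (fun f : ell2 p K => series (fun k => w k * `|f0 k - f k| ^+ 2) n) @ F
      --> series (fun k => w k * `|f0 k - g k| ^+ 2) n.
    rewrite /series/=; apply: cvg_big => [|k _]; first exact: add_continuous.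
    apply: cvgM; first exact: cvg_cst.
    under eq_cvg do rewrite expr2.
    rewrite expr2.
    have h : (fun f : ell2 p K => `|f0 k - f k|) @ F --> `|f0 k - g k|.
      by apply: cvg_norm; apply: cvgB; [exact: cvg_cst|exact: coordc].
    exact: cvgM.
  rewrite -(cvg_lim _ cv)//; apply: limr_le; first by apply/cvg_ex; eexists; exact: cv.
  near=> f.
  rewrite (_ : (fun k => _) = fun k => w k * `|(f0 - f) k| ^+ 2); last first.
    by apply/funext => k; rewrite ell2B.
  apply: le_trans (ell2_norm_ge _ _) _.
  rewrite ler_sqr ?nnegrE// ltW//; first by near: f.
have mem_g : g \in ell2_pred K p.
  have [f0 [_ h]] := key 1 ltr01.
  have d : (fun k => f0 k - g k) \in ell2_pred K p by apply/ell2_predP; exists (1 ^+ 2).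
  rewrite (_ : g = val f0 - (fun k => f0 k - g k)); last first.
    by apply/funext => k; rewrite /= opprB addrC subrK.
  by rewrite rpredB// ; exact: ell2_mem.
apply/cvg_ex; exists (Ell2 mem_g); apply/cvgrPdist_lt => /= e e0.
have e20 : 0 < e / 2 by rewrite divr_gt0.
have [f0 [Ff0 h]] := key _ e20.
near=> f.
rewrite (splitr e) -(subrKA f0) (le_lt_trans (ler_normD _ _))// ler_ltD//.
  rewrite distrC -ler_sqr ?nnegrE// ?(ltW e20)//.
  rewrite -[`|_|]/(ip_norm ell2_dot _) (ip_norm_sqr ell2_dot_ip).
  apply: ell2_dotxx_le => n; apply: le_trans (h n).
  by rewrite le_eqVlt; apply/orP; left; apply/eqP; congr (series _ n);
    apply/funext => k; rewrite ell2B.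
by near: f.
Unshelve. all: by end_near. Qed.

HB.instance Definition _ := Uniform_isComplete.Build (ell2 p K) ell2_complete.

HB.instance Definition _ := CompleteNormedModule_isHilbert.Build R (ell2 p K)
  ell2_dot_ip (fun=> erefl).

End Ell2.

Definition norms_nbhs (R : realType) (V : lmodType R) (nrm : nat -> V -> R)
    (x : V) : set_system V :=
  [set A | exists n, exists2 e : R, 0 < e &
    [set y | forall p, (p <= n)%N -> nrm p (y - x) < e] `<=` A].

Section NormsNbhs.
Context (R : realType) (V : lmodType R) (nrm : nat -> V -> R).
Hypothesis nrmD : forall p x y, nrm p (x + y) <= nrm p x + nrm p y.
Hypothesis nrmZ : forall p a x, nrm p (a *: x) = `|a| * nrm p x.

Let nrm0 p : nrm p 0 = 0.
Proof. by rewrite -(scale0r (0 : V)) nrmZ normr0 mul0r. Qed.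

Let nrm_ge0 p x : 0 <= nrm p x.
Proof.
have := nrmD p x (-1 *: x); rewrite scaleN1r subrr nrm0 -scaleN1r nrmZ normrN1.
by rewrite mul1r; lra.
Qed.

Lemma norms_nbhs_filter x : ProperFilter (norms_nbhs nrm x).
Proof.
split.
  by move=> [n [e e0 /(_ x)]]; apply => p _; rewrite subrr nrm0.
split=> [|A B [n [e e0 eA]] [m [d d0 dB]]|A B AB [n [e e0 eA]]].
- by exists 0%N, 1.
- exists (maxn n m), (Num.min e d); first by rewrite lt_min e0.
  move=> y xy; split; [apply: eA|apply: dB] => p pn.
    have := xy p; rewrite lt_min => h.
    by have /andP[] := h (leq_trans pn (leq_maxl _ _)).
  have := xy p; rewrite lt_min => h.
  by have /andP[] := h (leq_trans pn (leq_maxr _ _)).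
- by exists n, e => // y /eA /AB.
Qed.

Lemma norms_nbhs_singleton x A : norms_nbhs nrm x A -> A x.
Proof. by move=> [n [e e0]]; apply => p _; rewrite subrr nrm0. Qed.

Lemma norms_nbhs_nbhs x A :
  norms_nbhs nrm x A -> norms_nbhs nrm x (norms_nbhs nrm ^~ A).
Proof.
move=> [n [e e0 eA]]; exists n, (e / 2); first by rewrite divr_gt0.
move=> y xy; exists n, (e / 2); first by rewrite divr_gt0.
move=> z yz; apply: eA => p pn; rewrite -(subrKA y) (splitr e).
by rewrite (le_lt_trans (nrmD _ _ _))// ltrD// ?yz// xy.
Qed.

Lemma norms_nbhs_add x y A : norms_nbhs nrm (x + y) A ->
  exists B C, [/\ norms_nbhs nrm x B, norms_nbhs nrm y C &
    forall x' y', B x' -> C y' -> A (x' + y')].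
Proof.
move=> [n [e e0 eA]]; have e20 : 0 < e / 2 by rewrite divr_gt0.
exists [set x' | forall p, (p <= n)%N -> nrm p (x' - x) < e / 2].
exists [set x' | forall p, (p <= n)%N -> nrm p (x' - y) < e / 2].
split; [by exists n, (e / 2)..|] => x' y' xx' yy'; apply: eA => p pn.
rewrite opprD addrACA (splitr e) (le_lt_trans (nrmD _ _ _))// ltrD//.
  exact: xx'.
exact: yy'.
Qed.

Lemma norms_nbhs_scale (a : R) x A : norms_nbhs nrm (a *: x) A ->
  exists2 d : R, 0 < d & exists2 C, norms_nbhs nrm x C &
    forall b y, `|a - b| < d -> C y -> A (b *: y).
Proof.
move=> [n [e e0 eA]].
pose M := \sum_(p < n.+1) nrm p x.
have M0 : 0 <= M by apply: sumr_ge0 => p _; exact: nrm_ge0.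
have a0 := normr_ge0 a.
have M10 : 0 < M + 1 by lra.
have a10 : 0 < `|a| + 1 by lra.
have dM0 : 0 < e / 2 / (M + 1) by rewrite !divr_gt0.
exists (Num.min 1 (e / 2 / (M + 1))); first by rewrite lt_min ltr01.
exists [set y | forall p, (p <= n)%N -> nrm p (y - x) < e / 2 / (`|a| + 1)].
  by exists n, (e / 2 / (`|a| + 1)); rewrite ?divr_gt0.
move=> b y; rewrite lt_min => /andP[ab1 abM] xy; apply: eA => p pn.
rewrite (_ : b *: y - a *: x = b *: (y - x) + (b - a) *: x); last first.
  by rewrite scalerBr scalerBl subrKA.
rewrite (splitr e) (le_lt_trans (nrmD _ _ _))// ltr_leD// nrmZ.
  have ba : `|b| <= `|a| + 1.
    by rewrite -(subrK a b) addrC (le_trans (ler_normD _ _))// lerD2l distrC ltW.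
  apply: (@le_lt_trans _ _ ((`|a| + 1) * nrm p (y - x))).
    by rewrite ler_wpM2r.
  by rewrite mulrC -ltr_pdivlMr//; exact: xy.
have xM : nrm p x <= M + 1.
  rewrite /M (bigD1 (Ordinal (pn : (p < n.+1)%N)))//= -addrA lerDl addr_ge0//.
  by apply: sumr_ge0 => q _; exact: nrm_ge0.
apply: (@le_trans _ _ (e / 2 / (M + 1) * (M + 1))).
  by rewrite ler_pM// distrC ltW.
by rewrite divfK// gt_eqF.
Qed.

End NormsNbhs.

Definition norms_dist (R : realType) (V : lmodType R) (nrm : nat -> V -> R)
    (x y : V) : R :=
  limn (series (fun p => 2 ^- p * (nrm p (x - y) / (1 + nrm p (x - y))))).

Definition norms_complete (R : realType) (V : lmodType R)
    (nrm : nat -> V -> R) :=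
  forall u : nat -> V,
    (forall e : R, 0 < e -> exists n0, forall m n,
      (n0 <= m)%N -> (n0 <= n)%N -> norms_dist nrm (u m) (u n) < e) ->
    exists x, norms_dist nrm (u n) x @[n --> \oo] --> 0.

Definition norms_compatible (R : realType) (V : lmodType R)
    (nrm : nat -> V -> R) :=
  forall p q (u : nat -> V),
    nrm p (u n) @[n --> \oo] --> 0 ->
    (forall e : R, 0 < e -> exists n0, forall m n,
      (n0 <= m)%N -> (n0 <= n)%N -> nrm q (u m - u n) < e) ->
    nrm q (u n) @[n --> \oo] --> 0.

Definition separable (T : topologicalType) :=
  exists2 D : set T, countable D & dense D.

Definition infinite_dimensional (R : realType) (V : lmodType R) :=
  forall n (b : 'I_n -> V), exists x,
    forall c : 'I_n -> R, x <> \sum_(i < n) c i *: b i.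

Definition topological_dual (R : realType) (V : topologicalLmodType R) :
    set (V -> R) :=
  [set phi | linear (phi : V -> R^o) /\ continuous phi].
Arguments topological_dual {R} V _.

Definition linear_span (R : realType) (V : lmodType R) (E : set V) : set V :=
  [set x | exists n (c : 'I_n -> R) (b : 'I_n -> V),
    (forall i, E (b i)) /\ x = \sum_(i < n) c i *: b i].

Definition orthonormal_basis (R : realType) (K : hilbertType R) (E : set K) :=
  (forall x y, E x -> E y -> hdot x y = (x == y)%:R) /\ dense (linear_span E).

Definition hilbert_schmidt (R : realType) (K L : hilbertType R)
    (A : {linear K -> L}) :=
  continuous A /\
  exists2 E : set K, orthonormal_basis E &
    (\esum_(x in E) (`|A x| ^+ 2)%:E < +oo)%E.

Definition is_completion (R : realType) (V : lmodType R) (ip : V -> V -> R)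
    (K : hilbertType R) (j : {linear V -> K}) :=
  (forall x y, hdot (j x) (j y) = ip x y) /\ dense (range j).

(* A Hilbert space contained in H as a vector subspace, with a continuous
   inclusion, but carrying an inner product of its own. *)
Record hilbert_subspace (R : realType) (H : hilbertType R) := HilbertSubspace {
  hsub_space :> hilbertType R ;
  hsub_incl : {linear hsub_space -> H} ;
  hsub_incl_continuous : continuous hsub_incl ;
  hsub_incl_inj : injective hsub_incl }.

(* N is included in H by i, and H in N' by h |-> (h, i _). The completion N_p of
   N for the norm p is realized as a subspace of H, the inclusion into H being
   the extension of i; compatibility of the norms is what makes it injective. *)
Record gelfand_spaces (R : realType) (H : hilbertType R)
    (N : topologicalLmodType R) (N' : set (N -> R)) (i : {linear N -> H})
    (ip : nat -> N -> N -> R) (Np : nat -> hilbert_subspace H) : Prop :=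
  GelfandSpaces {
  gelfand_separable : separable H ;
  gelfand_ip : forall p, is_inner_product (ip p) ;
  gelfand_nbhs : forall x : N, nbhs x = norms_nbhs (fun p => ip_norm (ip p)) x ;
  gelfand_compatible : norms_compatible (fun p => ip_norm (ip p)) ;
  gelfand_increasing : forall p x, ip_norm (ip p) x <= ip_norm (ip p.+1) x ;
  gelfand_complete : norms_complete (fun p => ip_norm (ip p)) ;
  gelfand_completion : forall p,
    exists2 j : {linear N -> Np p},
      is_completion (ip p) j & forall x, hsub_incl (Np p) (j x) = i x ;
  gelfand_N0 : range (hsub_incl (Np 0%N)) = setT /\
    forall x y, hdot (hsub_incl (Np 0%N) x) (hsub_incl (Np 0%N) y) = hdot x y ;
  gelfand_hilbert_schmidt : forall p,
    exists2 A : {linear Np p.+1 -> Np p},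
      (forall x, hsub_incl (Np p) (A x) = hsub_incl (Np p.+1) x) &
      hilbert_schmidt A ;
  gelfand_dual : N' = topological_dual N ;
  gelfand_dual_incl : forall h, N' (fun xi => hdot h (i xi)) ;
  gelfand_dual_inj : injective (fun (h : H) (xi : N) => hdot h (i xi)) }.

Definition gelfand_triple (R : realType) (H : hilbertType R)
    (N : topologicalLmodType R) (N' : set (N -> R)) (i : {linear N -> H})
    (ip : nat -> N -> N -> R) : Prop :=
  exists Np : nat -> hilbert_subspace H, gelfand_spaces N' i ip Np.

(* The elements of ell^2_p(K), seen as sequences in H. The intersection over p
   of the ell^2_p(N_p) is the space s(N), called sseq below. *)
Definition ell2_in (R : realType) (H : hilbertType R) (p : int)
    (K : hilbert_subspace H) : set (nat -> H) :=
  [set f | exists g : ell2 p K, f = hsub_incl K \o g].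

Definition sseq_pred (R : realType) (H : hilbertType R)
    (Np : nat -> hilbert_subspace H) : {pred nat -> H} :=
  mem (\bigcap_(p : nat) ell2_in p%:Z (Np p)).
Arguments sseq_pred {R H} Np _.

Record sseq (R : realType) (H : hilbertType R) (Np : nat -> hilbert_subspace H) :=
  Sseq { sseq_seq :> nat -> H ; sseq_mem : sseq_seq \in sseq_pred Np }.

Section Sseq.
Context (R : realType) (H : hilbertType R) (Np : nat -> hilbert_subspace H).

Lemma sseq_submod_closed : submod_closed (sseq_pred Np).
Proof.
split.
  rewrite inE => p _; exists 0; apply/funext => k.
  by rewrite /comp ell20 linear0.
move=> a f g; rewrite !inE => fs gs p _.
have [f' ->] := fs p I; have [g' ->] := gs p I.
exists (a *: f' + g'); apply/funext => k.
by rewrite /comp ell2D ell2Z linearP.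
Qed.

HB.instance Definition _ :=
  GRing.isSubmodClosed.Build R (nat -> H) (sseq_pred Np) sseq_submod_closed.

HB.instance Definition _ := [isSub for @sseq_seq R H Np].
HB.instance Definition _ := [Choice of sseq Np by <:].
HB.instance Definition _ := [SubChoice_isSubLmodule of sseq Np by <:].

Lemma sseq_ell2_subproof (f : sseq Np) (p : nat) :
  exists g : ell2 p%:Z (Np p), val f = hsub_incl (Np p) \o g.
Proof. by have := sseq_mem f; rewrite inE => /(_ p I). Qed.

Definition sseq_ell2 (p : nat) (f : sseq Np) : ell2 p%:Z (Np p) :=
  sval (cid (sseq_ell2_subproof f p)).

Lemma sseq_ell2E p f k : hsub_incl (Np p) (sseq_ell2 p f k) = f k.
Proof. by rewrite /sseq_ell2; case: cid => g /= ->. Qed.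

Lemma sseq_ell2_linear p : linear (sseq_ell2 p).
Proof.
move=> a f g; apply/val_inj/funext => k; rewrite -[RHS]/(ell2_seq (a *: sseq_ell2 p f + sseq_ell2 p g) k).
rewrite -[LHS]/(ell2_seq (sseq_ell2 p (a *: f + g)) k).
apply: (@hsub_incl_inj R H (Np p)).
rewrite sseq_ell2E ell2D ell2Z linearP !sseq_ell2E.
by rewrite -[(a *: f + g) k]/(val (a *: f + g) k) linearP.
Qed.

HB.instance Definition _ p := GRing.isLinear.Build R (sseq Np)
  (ell2 p%:Z (Np p)) _ (sseq_ell2 p) (sseq_ell2_linear p).

Definition sseq_ip (p : nat) (f g : sseq Np) : R :=
  hdot (sseq_ell2 p f) (sseq_ell2 p g).

Lemma sseq_normE p f : ip_norm (sseq_ip p) f = `|sseq_ell2 p f|.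
Proof. by rewrite hdot_norm. Qed.

Let nrmD p (f g : sseq Np) : ip_norm (sseq_ip p) (f + g) <=
  ip_norm (sseq_ip p) f + ip_norm (sseq_ip p) g.
Proof. by rewrite !sseq_normE linearD ler_normD. Qed.

Let nrmZ p a (f : sseq Np) :
  ip_norm (sseq_ip p) (a *: f) = `|a| * ip_norm (sseq_ip p) f.
Proof. by rewrite !sseq_normE linearZ normrZ. Qed.

HB.instance Definition _ := hasNbhs.Build (sseq Np)
  (norms_nbhs (fun p => ip_norm (sseq_ip p))).

HB.instance Definition _ := Nbhs_isNbhsTopological.Build (sseq Np)
  (norms_nbhs_filter nrmZ) (norms_nbhs_singleton nrmZ)
  (norms_nbhs_nbhs nrmD).

Lemma sseq_add_continuous : continuous (fun f : sseq Np * sseq Np => f.1 + f.2).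
Proof.
move=> [f g] A /= /(norms_nbhs_add nrmD)[B [C [fB gC BCA]]].
by exists (B, C) => // -[f' g'] /= [] /BCA; apply.
Qed.

HB.instance Definition _ :=
  PreTopologicalNmodule_isTopologicalNmodule.Build (sseq Np) sseq_add_continuous.

Lemma sseq_scale_continuous : continuous (fun z : R^o * sseq Np => z.1 *: z.2).
Proof.
move=> [a f] A /= /(norms_nbhs_scale nrmD nrmZ)[d d0 [C fC aCA]].
exists (ball (a : R^o) d, C); first by split => //; exact: nbhsx_ballx.
by move=> [b g] /= [ab Cg]; apply: aCA => //; rewrite -ball_normE in ab.
Qed.

HB.instance Definition _ :=
  TopologicalNmodule_isTopologicalLmodule.Build R (sseq Np) sseq_scale_continuous.

Lemma sseq_incl_subproof (f : sseq Np) : (f : nat -> H) \in ell2_pred H 0.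
Proof.
have /continuous_linear_bounded : {for 0, continuous (hsub_incl (Np 0%N))}.
  exact: hsub_incl_continuous.
move=> /(_ 0)/linear_boundedP[M [_ /(_ (`|M| + 1))]].
have -> : M < `|M| + 1 by rewrite (le_lt_trans (ler_norm _))// ltrDl.
move=> /(_ isT) inclM.
have /ell2_predP[B fB] := ell2_mem (sseq_ell2 0%N f).
apply/ell2_predP; exists ((`|M| + 1) ^+ 2 * B) => n.
apply: le_trans (ler_wpM2l (sqr_ge0 _) (fB n)).
rewrite /series/= mulr_sumr; apply: ler_sum => k _.
rewrite [leRHS]mulrCA ler_pM2l ?ell2_weight_gt0// -(sseq_ell2E 0%N) -exprMn.
by rewrite ler_sqr ?nnegrE ?mulr_ge0 ?addr_ge0// inclM.
Qed.

Definition sseq_incl (f : sseq Np) : ell2 0 H := Ell2 (sseq_incl_subproof f).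

Lemma sseq_incl_linear : linear sseq_incl.
Proof.
by move=> a f g; apply/val_inj; rewrite !linearP.
Qed.

HB.instance Definition _ := GRing.isLinear.Build R (sseq Np) (ell2 0 H) _
  sseq_incl sseq_incl_linear.

End Sseq.
Arguments sseq_ip {R H} Np p f g.
Arguments sseq_incl {R H} Np f.

(* Main.v *)
Require Import Defs.
From HB Require Import structures.
From mathcomp Require Import all_boot all_order all_algebra.
From mathcomp Require Import all_classical all_reals all_analysis.
From mathcomp Require Import ring lra zify.

(* The Hilbert space completing s(N) for its p-th norm is ell^2_p(N_p) itself,
   included coordinatewise in ell^2(H).  Sequences supported at a single index
   reduce density, separability and orthonormal bases to the corresponding facts
   in one coordinate, while completeness and compatibility hold because
   convergence in ell^2_p(N_p) determines every coordinate in H.  The inclusion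
   of ell^2_(p+1)(N_(p+1)) in ell^2_p(N_p) is Hilbert-Schmidt because the weights
   contribute a factor (k+1)^(-2), whose sum over k is finite. *)

Set Implicit Arguments.
Unset Strict Implicit.
Unset Printing Implicit Defensive.

Import Order.TTheory GRing.Theory Num.Theory.
Import numFieldNormedType.Exports.

Local Open Scope classical_set_scope.
Local Open Scope ring_scope.

(** * Density and bounded operators in normed spaces *)

Lemma dense_normP (R : realType) (V : normedModType R) (D : set V) :
  dense D <-> forall x (e : R), 0 < e -> exists2 y, D y & `|x - y| < e.
Proof.
split=> [dD x e e0|h O [x Ox] oO].
  have [] := dD (ball x e).
  - by exists x; exact: ballxx.
  - exact: ball_open.
  - by move=> y []; rewrite -ball_normE /= => xy Dy; exists y.
have /nbhs_ballP[e e0 eO] : nbhs x O by exact: open_nbhs_nbhs.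
have [y Dy xy] := h x e e0.
by exists y; split => //; apply: eO; rewrite -ball_normE.
Qed.

Lemma continuous_linear_le (R : realType) (V W : normedModType R)
    (T : {linear V -> W}) :
  continuous T -> exists2 C : R, 0 <= C & forall x, `|T x| <= C * `|x|.
Proof.
move=> /(_ 0)/continuous_linear_bounded/linear_boundedP[M [_ TM]].
exists (`|M| + 1) => //.
by move=> x; apply: TM; rewrite (le_lt_trans (ler_norm _))// ltrDl.
Qed.

Lemma linear_le_continuous (R : realType) (V W : normedModType R)
    (T : {linear V -> W}) (C : R) :
  (forall x, `|T x| <= C * `|x|) -> continuous T.
Proof.
move=> TC; apply/bounded_linear_continuous/linear_boundedP.
exists C; split; first exact: num_real.
by move=> r /ltW Cr x; rewrite (le_trans (TC x))// ler_wpM2r.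
Qed.

(** * Bilinearity of the inner product *)

Section HdotTheory.
Context (R : realType) (K : hilbertType R).
Implicit Types x y z : K.

Lemma hdotC x y : hdot x y = hdot y x.
Proof. exact: (ipC (@hdot_ip _ _)). Qed.

Lemma hdotDr x y z : hdot z (x + y) = hdot z x + hdot z y.
Proof. exact: (ipDr (@hdot_ip _ _)). Qed.

Lemma hdotZr a x y : hdot x (a *: y) = a * hdot x y.
Proof. exact: (ipZr (@hdot_ip _ _)). Qed.

Lemma hdot0r x : hdot x 0 = 0.
Proof. by rewrite hdotC (ip0l (@hdot_ip _ _)). Qed.

Lemma hdotBl x y z : hdot (x - y) z = hdot x z - hdot y z.
Proof. by rewrite hdotC -scaleN1r hdotDr hdotZr mulN1r !(hdotC z). Qed.

Lemma hdot_sumr (I : Type) (s : seq I) (f : I -> K) x :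
  hdot x (\sum_(i <- s) f i) = \sum_(i <- s) hdot x (f i).
Proof.
by elim/big_rec2: _ => [|i a b _ <-]; rewrite ?hdot0r// hdotDr.
Qed.

End HdotTheory.

(** * Singly supported sequences and truncation in weighted sequence spaces *)

Section Ell2Single.
Context (R : realType) (K : hilbertType R) (p : int).
Implicit Types (f g : ell2 p K) (x : K).

Local Notation w := (ell2_weight R p).

Lemma ell2_dot_cvg f g :
  series (fun k => w k * hdot (f k) (g k)) n @[n --> \oo] --> hdot f g.
Proof. exact: is_cvg_ell2_dot. Qed.

Lemma ell2_eq f g : (forall k, f k = g k) -> f = g.
Proof. by move=> fg; apply/val_inj/funext => k; exact: fg. Qed.

Lemma ell2_sum (I : Type) (s : seq I) (h : I -> ell2 p K) k :
  (\sum_(i <- s) h i) k = \sum_(i <- s) h i k.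
Proof. by elim/big_rec2: _ => [|i a b _ <-]; rewrite ?ell20// ell2D. Qed.

(** The norm of a sequence dominates the norm of its [k]-th coordinate times the positive constant
    [Num.sqrt (w k)]. *)
Lemma ell2_coord_cvg (u : nat -> ell2 p K) f k :
  u n @[n --> \oo] --> f -> u n k @[n --> \oo] --> f k.
Proof.
move=> uf; apply/cvgrPdist_lt => e e0.
have c0 : 0 < Num.sqrt (w k) by rewrite sqrtr_gt0 ell2_weight_gt0.
have /cvgrPdist_lt/(_ _ (mulr_gt0 c0 e0)) := uf.
apply: filterS => n h; rewrite -ell2B -(ltr_pM2l c0); apply: le_lt_trans h.
rewrite -ler_sqr ?nnegrE ?mulr_ge0 ?(ltW c0)// exprMn sqr_sqrtr.
  exact: ell2_norm_coord.
exact/ltW/ell2_weight_gt0.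
Qed.

Definition single_seq k x : nat -> K := fun n => if n == k then x else 0.

Lemma single_seq_mem k x : single_seq k x \in ell2_pred K p.
Proof.
apply/ell2_predP; exists (w k * `|x| ^+ 2) => n; rewrite /series/= big_mkord.
have [kn|nk] := ltnP k n.
  rewrite (bigD1 (Ordinal kn))//= /single_seq eqxx big1 ?addr0// => m.
  by rewrite -val_eqE /= => /negPf ->; rewrite normr0 expr0n mulr0.
rewrite big1 => [|m _]; first exact: (ell2_term_ge0 p (fun=> x) k).
by rewrite /single_seq ltn_eqF ?(leq_trans _ nk)// normr0 expr0n mulr0.
Qed.

Definition single k x : ell2 p K := Ell2 (single_seq_mem k x).

Lemma singleE k x n : single k x n = if n == k then x else 0.
Proof. by []. Qed.

Lemma single_linear k : linear (single k).
Proof.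
move=> a x y; apply: ell2_eq => n; rewrite ell2D ell2Z !singleE.
by case: ifP; rewrite ?scaler0 ?addr0.
Qed.

HB.instance Definition _ k :=
  GRing.isLinear.Build R K (ell2 p K) _ (single k) (single_linear k).

Lemma hdot_single f k x : hdot f (single k x) = w k * hdot (f k) x.
Proof.
have c : series (fun m => w m * hdot (f m) (single k x m)) n @[n --> \oo] -->
    w k * hdot (f k) x.
  (* Only the term of index [k] is nonzero, so the partial sums are constant as soon as [n > k]. *)
  apply: cvg_near_cst; near=> n.
  rewrite /series/= big_mkord.
  have kn : (k < n)%N by near: n; exact: nbhs_infty_gt.
  rewrite (bigD1 (Ordinal kn))//= {1}/single_seq eqxx big1 ?addr0// => m.
  rewrite /single_seq.
  by rewrite -val_eqE /= => /negPf ->; rewrite hdot0r mulr0.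
by rewrite -(cvg_lim _ (@ell2_dot_cvg f _))// (cvg_lim _ c).
Unshelve. all: by end_near. Qed.

Lemma norm_single k x : `|single k x| = Num.sqrt (w k) * `|x|.
Proof.
rewrite !hdot_norm /ip_norm hdot_single singleE eqxx sqrtrM//.
exact/ltW/ell2_weight_gt0.
Qed.

Definition trunc f n : ell2 p K := \sum_(k < n) single k (f k).

(** The truncation is an orthogonal projection of [f], so the squared error is [hdot f f] minus the
    [n]-th partial sum of the series defining [hdot f f]. *)
Lemma trunc_cvg f : trunc f n @[n --> \oo] --> f.
Proof.
pose s n := series (fun k => w k * hdot (f k) (f k)) n.
have ft n : hdot f (trunc f n) = s n.
  rewrite hdot_sumr /s /series/= big_mkord.
  by apply: eq_bigr => k _; rewrite hdot_single.
have tt n : hdot (trunc f n) (trunc f n) = s n.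
  rewrite {2}/trunc hdot_sumr /s /series/= big_mkord.
  apply: eq_bigr => k _; rewrite hdot_single; congr (_ * hdot _ _).
  rewrite /trunc ell2_sum (bigD1 k)//= {1}/single_seq eqxx big1 ?addr0//
    => j jk.
  rewrite /single_seq.
  by rewrite -val_eqE /= eq_sym in jk; rewrite (negPf jk).
have sE n : `|f - trunc f n| ^+ 2 = hdot f f - s n.
  rewrite -hdotxx hdotBl !(hdotC _ (f - _)) !hdotBl tt (hdotC _ f) ft.
  by rewrite subrr subr0.
apply/cvgrPdist_lt => e e0.
have /cvgrPdist_lt/(_ _ (exprn_gt0 2 e0)) := @ell2_dot_cvg f f.
apply: filterS => n; rewrite -sE ger0_norm ?sqr_ge0// ltr_sqr ?nnegrE//.
exact: ltW.
Qed.

Lemma single_approx (D : set K) : dense D ->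
  forall f (e : R), 0 < e -> exists n (x : nat -> K),
    (forall k, D (x k)) /\ `|f - \sum_(k < n) single k (x k)| < e.
Proof.
move=> /dense_normP dD f e e0; have e20 : 0 < e / 2 by rewrite divr_gt0.
have /cvgrPdist_lt/(_ _ e20)[n _ /(_ n (leqnn n))/= fn] := @trunc_cvg f.
have n0 : (0 : R) < n.+1%:R by rewrite ltr0n.
have sw k : 0 < Num.sqrt (w k) by rewrite sqrtr_gt0 ell2_weight_gt0.
(* Half of [e] is spent on the tail and half is shared among the [n] coordinates. Dividing by
   [Num.sqrt (w k)] offsets the norm of [single k]; [n.+1] keeps the denominator positive when
   [n = 0]. *)
have hx k : exists y, D y /\ `|f k - y| < e / 2 / n.+1%:R / Num.sqrt (w k).
  by have [|y] := dD (f k) (e / 2 / n.+1%:R / Num.sqrt (w k));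
    [rewrite !divr_gt0|exists y].
have [x xP] := choice hx.
exists n, x; split => [k|]; first by have [] := xP k.
rewrite -(subrKA (trunc f n)) (splitr e) (le_lt_trans (ler_normD _ _))//.
rewrite ltr_leD// /trunc -sumrB.
apply: le_trans (ler_norm_sum _ _ _) _.
apply: (@le_trans _ _ (\sum_(k < n) e / 2 / n.+1%:R)).
  apply: ler_sum => k _; rewrite -linearB norm_single mulrC -ler_pdivlMr//.
  by have [_ /ltW] := xP k.
rewrite sumr_const card_ord -[leLHS]mulr_natr -[leLHS]mulrA.
rewrite ler_piMr ?(ltW e20)//.
by rewrite ler_pdivrMl// mulr1 ler_nat.
Qed.

End Ell2Single.

(** * Separability *)

Lemma ell2_separable (R : realType) (K : hilbertType R) (p : int) :
  separable K -> separable (ell2 p K).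
Proof.
move=> [D cD dD].
pose U n := [set \sum_(k < n) single p k (x k) | x in [set x : nat -> K |
  forall k, D (x k)]].
exists (\bigcup_n U n); last first.
  apply/dense_normP => f e e0; have [n [x [xD fx]]] := single_approx dD f e0.
  by exists (\sum_(k < n) single p k (x k)) => //; exists n => //; exists x.
(* Splitting off the last coordinate covers [U n.+1] by an image of the product of [U n] and [D]. *)
apply: bigcup_countable => // n _; elim: n => [|n cU].
  apply: (@sub_countable _ _ _ [set (0 : ell2 p K)]); last exact: countable1.
  by apply: subset_card_le => _ [x _ <-] /=; rewrite big_ord0.
apply: (@sub_countable _ _ _
  [set y.1 + single p n y.2 | y in U n `*` D]); last first.
  by apply: sub_countable (card_image_le _ _) _; exact: countableX.
apply: subset_card_le => _ [x xD <-] /=.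
exists (\sum_(k < n) single p k (x k), x n); last by rewrite big_ord_recr.
by split => /=; [exists x|exact: xD].
Qed.

(** * Closure properties of linear spans *)

Section LinearSpan.
Context (R : realType) (V : lmodType R) (E : set V).

Lemma linear_span0 : linear_span E 0.
Proof.
by exists 0%N, (fun=> 0), (fun=> 0); split; [case|rewrite big_ord0].
Qed.

Lemma linear_spanD x y :
  linear_span E x -> linear_span E y -> linear_span E (x + y).
Proof.
move=> [m [c [b [Eb ->]]]] [n [d [a [Ea ->]]]].
exists (m + n)%N.
exists (fun j => match fintype.split j with inl k => c k | inr k => d k end).
exists (fun j => match fintype.split j with inl k => b k | inr k => a k end).
split=> [j|]; first by case: fintype.split.
by rewrite big_split_ord /=; congr (_ + _); apply: eq_bigr => j _;
  [case: split_ordP => k /eqP|case: split_ordP => k /eqP];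
  rewrite ?eq_lshift ?eq_rshift ?eq_lrshift ?eq_rlshift// => /eqP ->.
Qed.

Lemma linear_spanZ a x : linear_span E x -> linear_span E (a *: x).
Proof.
move=> [n [c [b [Eb ->]]]]; exists n, (fun j => a * c j), b; split => //.
by rewrite scaler_sumr; apply: eq_bigr => j _; rewrite scalerA.
Qed.

Lemma linear_span_gen x : E x -> linear_span E x.
Proof.
move=> Ex; exists 1%N, (fun=> 1), (fun=> x); split => //.
by rewrite big_ord1 scale1r.
Qed.

Lemma linear_span_sum n (f : 'I_n -> V) :
  (forall j, linear_span E (f j)) -> linear_span E (\sum_(j < n) f j).
Proof.
move=> Ef; elim/big_ind: _ => //; first exact: linear_span0.
exact: linear_spanD.
Qed.

End LinearSpan.

(** * Operators applied coordinatewise *)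

Section Ell2Map.
Context (R : realType) (K L : hilbertType R) (p q : int) (T : {linear K -> L}).
Hypotheses (Tc : continuous T) (pq : p <= q).

Let ell2_weight_le k : ell2_weight R p k <= ell2_weight R q k.
Proof.
by apply: ler_weXz2l; [rewrite ler1n|rewrite lerMn2r].
Qed.

Let ell2_map_series_le C (f : ell2 q K) n :
  (forall x, `|T x| <= C * `|x|) ->
  series (fun k => ell2_weight R p k * `|T (f k)| ^+ 2) n <= C ^+ 2 * `|f| ^+ 2.
Proof.
move=> TC; apply: le_trans (ler_wpM2l (sqr_ge0 _) (ell2_norm_ge f n)).
rewrite /series/= mulr_sumr; apply: ler_sum => k _.
rewrite [leRHS]mulrCA -exprMn ler_pM ?sqr_ge0//.
  exact/ltW/ell2_weight_gt0.
by rewrite ler_sqr ?nnegrE// (le_trans _ (TC _)).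
Qed.

Lemma ell2_map_mem (f : ell2 q K) : T \o f \in ell2_pred L p.
Proof.
have [C C0 TC] := continuous_linear_le Tc.
apply/ell2_predP; exists (C ^+ 2 * `|f| ^+ 2) => n.
exact: ell2_map_series_le.
Qed.

Definition ell2_map (f : ell2 q K) : ell2 p L := Ell2 (ell2_map_mem f).

Lemma ell2_mapE f k : ell2_map f k = T (f k).
Proof. by []. Qed.

Lemma ell2_map_linear : linear ell2_map.
Proof.
move=> a f g; apply: ell2_eq => k.
by rewrite ell2D ell2Z !ell2_mapE ell2D ell2Z linearP.
Qed.

HB.instance Definition _ :=
  GRing.isLinear.Build R (ell2 q K) (ell2 p L) _ ell2_map ell2_map_linear.

Lemma norm_ell2_map C f : 0 <= C ->
  (forall x, `|T x| <= C * `|x|) -> `|ell2_map f| <= C * `|f|.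
Proof.
move=> C0 TC; rewrite -ler_sqr ?nnegrE ?mulr_ge0// exprMn -hdotxx.
by apply: ell2_dotxx_le => n; exact: ell2_map_series_le.
Qed.

Lemma ell2_map_continuous : continuous ell2_map.
Proof.
have [C C0 TC] := continuous_linear_le Tc.
by apply: (@linear_le_continuous _ _ _ _ C) => f; exact: norm_ell2_map.
Qed.

Lemma ell2_map_inj : injective T -> injective ell2_map.
Proof.
by move=> Tinj f g fg; apply: ell2_eq => k; apply: Tinj; rewrite -!ell2_mapE fg.
Qed.

Lemma ell2_map_single k x : ell2_map (single q k x) = single p k (T x).
Proof.
apply: ell2_eq => n; rewrite ell2_mapE !singleE.
by case: ifP => // _; rewrite linear0.
Qed.

End Ell2Map.

(** * Orthonormal bases and Hilbert-Schmidt operators on sequence spaces *)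

Section Ell2Basis.
Context (R : realType) (K : hilbertType R) (q : int) (E : set K).
Hypothesis onE : orthonormal_basis E.

Let c k : R := (Num.sqrt (ell2_weight R q k))^-1.

Let c_gt0 k : 0 < c k.
Proof. by rewrite invr_gt0 sqrtr_gt0 ell2_weight_gt0. Qed.

Let c_sqr k : ell2_weight R q k * (c k * c k) = 1.
Proof.
rewrite -expr2 /c exprVn sqr_sqrtr ?mulfV//.
  by rewrite gt_eqF ?ell2_weight_gt0.
exact/ltW/ell2_weight_gt0.
Qed.

(** The scalar makes this a unit vector when [x] is one, since [single q k] multiplies norms by the
    square root of the weight. *)
Definition ell2_basis_elt (x : K) (k : nat) : ell2 q K :=
  (Num.sqrt (ell2_weight R q k))^-1 *: single q k x.

(** Allows sums over the basis of the sequence space to be reindexed by pairs of a vector of [E] and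
    an index. *)
Lemma ell2_basis_elt_inj :
  set_inj (E `*`` (fun=> [set: nat])) (fun z => ell2_basis_elt z.1 z.2).
Proof.
move=> [x k] [y l]; rewrite !inE /= => -[/= Ex _] [/= Ey _] xy.
(* Vectors of [E] have norm 1. If the indices differed, coordinate [k] would be a nonzero multiple
   of [x] on one side and 0 on the other. *)
have nz z : E z -> z <> 0.
  move=> Ez z0; have := onE.1 _ _ Ez Ez; rewrite eqxx z0 hdot0r => /eqP.
  by rewrite eq_sym oner_eq0.
have := congr1 (fun f : ell2 q K => f k) xy.
rewrite /ell2_basis_elt !ell2Z !singleE eqxx /= -!/(c _).
case: eqP => [->|_].
  by move/(scalerI (lt0r_neq0 (c_gt0 l))) => ->.
rewrite scaler0 => /eqP; rewrite scaler_eq0 gt_eqF//= => /eqP.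
by move/(nz _ Ex).
Qed.

(** Distinct indices give disjoint supports, and equal indices reduce to orthonormality of [E].
    Density follows by approximating with finitely many coordinates, each taken in the span of
    [E]. *)
Lemma ell2_basis :
  orthonormal_basis
    [set ell2_basis_elt z.1 z.2 | z in E `*`` (fun=> [set: nat])].
Proof.
split.
  move=> _ _ [[x k] [/= Ex _] <-] [[y l] [/= Ey _] <-].
  have xkE : (x, k) \in E `*`` (fun=> [set: nat]) by rewrite inE.
  have ylE : (y, l) \in E `*`` (fun=> [set: nat]) by rewrite inE.
  have /= -> := inj_in_eq ell2_basis_elt_inj xkE ylE.
  rewrite xpair_eqE.
  rewrite /ell2_basis_elt/= -!/(c _) hdotZr hdot_single ell2Z singleE.
  rewrite eq_sym; case: eqP => [->|_].
    rewrite hdotC hdotZr andbT onE.1// [x == y]eq_sym.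
    by rewrite -[RHS]mul1r -(c_sqr l); ring.
  by rewrite scaler0 hdotC hdot0r !mulr0 andbF.
apply/dense_normP => f e e0.
have [n [x [xE fx]]] := single_approx onE.2 f e0.
exists (\sum_(k < n) single q k (x k)) => //.
apply: linear_span_sum => k; have [m [a [b [Eb ->]]]] := xE k.
rewrite linear_sum; apply: linear_span_sum => j.
rewrite linearZ /=; apply: linear_spanZ.
have -> : single q k (b j) = (c k)^-1 *: ell2_basis_elt (b j) k.
  by rewrite /ell2_basis_elt /= -/(c k) scalerA mulVf ?scale1r// lt0r_neq0.
apply/linear_spanZ/linear_span_gen; exists (b j, k : nat) => //.
by split => //; exact: Eb.
Qed.

End Ell2Basis.

Lemma sum_inv_sqr_le (R : realType) n :
  \sum_(0 <= k < n) (k.+1%:R ^+ 2 : R)^-1 <= 2.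
Proof.
(* The subtracted term makes the induction go through: the new summand is less than the gap between
   two consecutive reciprocals. *)
suff h m : \sum_(0 <= k < m.+1) (k.+1%:R ^+ 2 : R)^-1 <= 2 - m.+1%:R^-1.
  case: n => [|n]; first by rewrite big_geq.
  by rewrite (le_trans (h n))// gerBl invr_ge0.
elim: m => [|m IH].
  by rewrite big_nat1 expr1n invr1; lra.
rewrite big_nat_recr//=; apply: le_trans (lerD IH (lexx _)) _.
have m0 : (0 : R) < m.+1%:R by rewrite ltr0n.
have m2 : (0 : R) < m.+2%:R by rewrite ltr0n.
rewrite -subr_ge0; move: m0 m2; rewrite -[m.+2%:R]natr1.
move: (m.+1%:R : R) => a a0 a1.
have -> : 2 - a^-1 + ((a + 1) ^+ 2)^-1 = 2 - (a + 1)^-1 - (a * (a + 1) ^+ 2)^-1.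
  by field; rewrite !gt_eqF.
by rewrite subKr invr_ge0 mulr_ge0// ?sqr_ge0 ?ltW.
Qed.

(* In the basis single k e / (k+1)^q the squared Hilbert-Schmidt norm of
   ell2_map T is the sum over k of (k+1)^(2p-2q) <= (k+1)^(-2), times that of
   T. *)
Lemma ell2_map_hilbert_schmidt (R : realType) (K L : hilbertType R) (p q : int)
    (T : {linear K -> L}) (Tc : continuous T) (pq : p <= q) :
  p + 1 <= q -> hilbert_schmidt T -> hilbert_schmidt (ell2_map Tc pq).
Proof.
move=> p1q [_ [E onE hsE]]; split; first exact: ell2_map_continuous.
exists [set ell2_basis_elt q z.1 z.2 | z in E `*`` (fun=> [set: nat])].
  exact: ell2_basis.
rewrite esum_image; last exact: ell2_basis_elt_inj.
rewrite -(esum_esum (a := fun x k => (`|ell2_map Tc pq (ell2_basis_elt q x k)|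
   ^+ 2)%:E))//.
(* The sum over [k] contributes a factor of at most 2, written as two copies so that finiteness
   follows from additivity of [esum]. *)
apply: (@le_lt_trans _ _
  (\esum_(x in E) ((`|T x| ^+ 2)%:E + (`|T x| ^+ 2)%:E))%E).
  apply: le_esum => x _; rewrite -nneseries_esumT; last first.
    by move=> k; rewrite lee_fin sqr_ge0.
  apply: lime_le.
    by apply: is_cvg_nneseries => *; rewrite lee_fin sqr_ge0.
  apply: nearW => n; rewrite sumEFin -EFinD lee_fin.
  apply: (@le_trans _ _ (\sum_(0 <= k < n) (k.+1%:R ^+ 2)^-1 * `|T x| ^+ 2)).
    apply: ler_sum => k _.
    rewrite /ell2_basis_elt linearZ/= ell2_map_single normrZ norm_single.
    have wp := ell2_weight_gt0 R p k; have wq := ell2_weight_gt0 R q k.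
    rewrite ger0_norm ?invr_ge0 ?sqrtr_ge0// mulrA exprMn ler_wpM2r ?sqr_ge0//.
    rewrite exprMn exprVn !sqr_sqrtr ?(ltW wp) ?(ltW wq)// mulrC ler_pdivrMr//.
    rewrite mulrC ler_pdivlMr ?exprn_gt0 ?ltr0n//.
    rewrite /ell2_weight exprnP -expfzDr ?pnatr_eq0//.
    by apply: ler_weXz2l; [rewrite ler1n|lia].
  rewrite -mulr_suml -mulr2n -[leRHS]mulr_natl ler_wpM2r ?sqr_ge0//.
  exact: sum_inv_sqr_le.
rewrite esumD; [|by move=> *; rewrite lee_fin sqr_ge0..].
by rewrite lte_add_pinfty.
Qed.

(** * Cauchy sequences and the metric built from a family of norms *)

Lemma cauchy_seq_cvgn (R : realType) (V : completeNormedModType R)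
    (u : nat -> V) :
  (forall e : R, 0 < e -> exists n0, forall m n,
    (n0 <= m)%N -> (n0 <= n)%N -> `|u m - u n| < e) -> cvgn u.
Proof.
move=> uc; apply/cauchy_cvgP/cauchyP => e e0; have [n0 h] := uc e e0.
exists (u n0); exists n0 => // n /= nn0; rewrite -ball_normE /=.
exact: h.
Qed.

Section NormsDist.
Context (R : realType) (V : lmodType R) (nrm : nat -> V -> R).
Hypothesis nrm_ge0 : forall p x, 0 <= nrm p x.
Implicit Types x y : V.

Let t x y p : R := 2 ^- p * (nrm p (x - y) / (1 + nrm p (x - y))).

Let den_gt0 x y p : 0 < 1 + nrm p (x - y).
Proof. by rewrite ltr_pwDl. Qed.

Let t_ge0 x y p : 0 <= t x y p.
Proof. by rewrite mulr_ge0 ?invr_ge0 ?exprn_ge0// divr_ge0// ltW. Qed.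

Let t_le x y p : t x y p <= 2 ^- p.
Proof.
rewrite /t ger_pMr ?invr_gt0 ?exprn_gt0// ler_pdivrMr// mul1r.
by rewrite lerDr.
Qed.

Let t_le_nrm x y p : t x y p <= nrm p (x - y).
Proof.
apply: (@le_trans _ _ (1 * (nrm p (x - y) / (1 + nrm p (x - y))))).
  rewrite ler_wpM2r ?divr_ge0 ?(ltW (den_gt0 _ _ _))// invf_le1 ?exprn_gt0//.
  by rewrite exprn_ege1// ler1n.
by rewrite mul1r ler_pdivrMr// ler_peMr// lerDl.
Qed.

Let t_nd x y : nondecreasing_seq (series (t x y)).
Proof. exact: nondecreasing_series. Qed.

Let t_cvg x y : cvgn (series (t x y)).
Proof.
apply: (@series_le_cvg _ _ (geometric 1 2^-1)) => // [p|p|].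
- by rewrite /= mul1r exprn_ge0.
- by rewrite /= mul1r exprVn.
- by apply: is_cvg_geometric_series; rewrite ger0_norm// invf_lt1// ltr1n.
Qed.

Lemma norms_dist_ge p x y :
  2 ^- p * (nrm p (x - y) / (1 + nrm p (x - y))) <= norms_dist nrm x y.
Proof.
apply: le_trans (nondecreasing_cvgn_le (@t_nd x y) (@t_cvg x y) p.+1).
by rewrite /series/= big_nat_recr//= lerDr sumr_ge0.
Qed.

Lemma norms_dist_ge0 x y : 0 <= norms_dist nrm x y.
Proof. exact: le_trans (@t_ge0 x y 0%N) (@norms_dist_ge 0 x y). Qed.

(** The first [P] terms are bounded by the norms themselves and the others by [2 ^- p], whose sum
    from [P] on is [2 / 2 ^+ P]. *)
Lemma norms_dist_le P x y :
  norms_dist nrm x y <= \sum_(0 <= p < P) nrm p (x - y) + 2 / 2 ^+ P.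
Proof.
apply: limr_le; first exact: t_cvg.
apply: nearW => n; apply: le_trans (@t_nd x y n (P + n)%N _) _.
  exact: leq_addl.
(* Subtracting the part of the geometric tail not yet consumed gives a bound that is inductive in
   [n]. *)
suff : series (t x y) (P + n)%N <=
    \sum_(0 <= p < P) nrm p (x - y) + 2 / 2 ^+ P - 2 / 2 ^+ (P + n)%N.
  move=> /le_trans; apply; rewrite gerBl divr_ge0// exprn_ge0//.
elim: n => [|n IH].
  by rewrite addn0 addrK /series/=; apply: ler_sum => p _; exact: t_le_nrm.
rewrite addnS /series/= big_nat_recr//=.
apply: le_trans (lerD IH (@t_le x y _)) _.
rewrite -addrA lerD2l exprS invfM mulrA mulfV ?mul1r//; lra.
Qed.

Lemma norms_dist_cauchy (u : nat -> V) :
  (forall e : R, 0 < e -> exists n0, forall m n,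
    (n0 <= m)%N -> (n0 <= n)%N -> norms_dist nrm (u m) (u n) < e) ->
  forall p (e : R), 0 < e -> exists n0, forall m n,
    (n0 <= m)%N -> (n0 <= n)%N -> nrm p (u m - u n) < e.
Proof.
move=> uc p e e0; have e1 : 0 < 1 + e by rewrite addr_gt0.
(* As [s / (1 + s)] increases with [s >= 0], a distance below this threshold forces the [p]-th norm
   below [e]. *)
have d0 : 0 < 2 ^- p * (e / (1 + e)).
  by rewrite mulr_gt0 ?divr_gt0// invr_gt0 exprn_gt0.
have [n0 h] := uc _ d0; exists n0 => m n n0m n0n.
have := le_lt_trans (norms_dist_ge p (u m) (u n)) (h _ _ n0m n0n).
rewrite ltr_pM2l ?invr_gt0 ?exprn_gt0//.
by rewrite ltr_pdivrMr// mulrAC ltr_pdivlMr// !mulrDr !mulr1 mulrC ltrD2r.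
Qed.

(** A large [P] makes the geometric tail small uniformly in [n]; the remaining finite sum of norms
    tends to 0. *)
Lemma norms_dist_cvg (u : nat -> V) x :
  (forall p, nrm p (u n - x) @[n --> \oo] --> 0) ->
  norms_dist nrm (u n) x @[n --> \oo] --> 0.
Proof.
move=> ux; apply/cvgrPdist_lt => e e0.
have [P _ hP] : \forall P \near \oo, `|0 - geometric 2 (2^-1 : R) P| < e / 2.
  have /cvgrPdist_lt : geometric 2 (2^-1 : R) @ \oo --> 0.
    by apply: cvg_geometric; rewrite ger0_norm// invf_lt1// ltr1n.
  by apply; rewrite divr_gt0.
have {hP} := hP P (leqnn P).
rewrite /= sub0r normrN exprVn ger0_norm; last first.
  by rewrite divr_ge0// exprn_ge0.
move=> hP.
have : \sum_(0 <= p < P) nrm p (u n - x) @[n --> \oo] -->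
    \sum_(0 <= p < P) (0 : R).
  by apply: cvg_big => [|p _]; [exact: add_continuous|exact: ux].
rewrite big1// => /cvgrPdist_lt/(_ (e / 2)) [|n0 _ h].
  by rewrite divr_gt0.
exists n0 => // n /h.
rewrite /= !sub0r !normrN !ger0_norm ?norms_dist_ge0//; last first.
  by rewrite sumr_ge0.
by move=> {}h; apply: le_lt_trans (@norms_dist_le P (u n) x) _; lra.
Qed.

End NormsDist.

(** * Weighted sequence spaces as Hilbert subspaces of the unweighted one *)

Section Ell2Subspace.
Context (R : realType) (H : hilbertType R) (K : hilbert_subspace H) (p : nat).

Definition ell2_incl : {linear ell2 p%:Z K -> ell2 0 H} :=
  ell2_map (@hsub_incl_continuous _ _ K) (le0z_nat p).

Definition ell2_subspace : hilbert_subspace (ell2 0 H) :=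
  @HilbertSubspace _ _ (ell2 p%:Z K) ell2_incl
    (@ell2_map_continuous _ _ _ _ _ _ _ _)
    (ell2_map_inj (@hsub_incl_inj _ _ K)).

End Ell2Subspace.

(** * The Gel'fand conditions for s(N) *)

Section SseqGelfand.
Context (R : realType) (H : hilbertType R) (N : topologicalLmodType R)
  (N' : set (N -> R)) (i : {linear N -> H}) (ip : nat -> N -> N -> R)
  (Np : nat -> hilbert_subspace H).
Hypothesis G : gelfand_spaces N' i ip Np.

Local Notation nrm p := (ip_norm (sseq_ip Np p)).
Implicit Types f g : sseq Np.

Lemma sseq_ip_inner p : is_inner_product (sseq_ip Np p).
Proof.
split=> [f g|f g h|a f g|f|f f0].
- exact: hdotC.
- by rewrite /sseq_ip linearD hdotC hdotDr !(hdotC _ (sseq_ell2 p h)).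
- by rewrite /sseq_ip linearZ hdotC hdotZr hdotC.
- by rewrite /sseq_ip hdotxx sqr_ge0.
apply/val_inj/funext => k /=; rewrite -(sseq_ell2E p).
have -> : sseq_ell2 p f = 0 by apply: (ip_eq0 (@hdot_ip _ _)).
by rewrite ell20 linear0.
Qed.

(** On the image of [N] the bound is the monotonicity of the norms of [N]; density and continuity
    carry it, with constant 1, to the completion. *)
Lemma gelfand_embed_le p (A : {linear Np p.+1 -> Np p}) : continuous A ->
  (forall x, hsub_incl (Np p) (A x) = hsub_incl (Np p.+1) x) ->
  forall x, `|A x| <= `|x|.
Proof.
move=> Ac AE x; have [C C0 AC] := continuous_linear_le Ac.
have [j [jip jd] jE] := gelfand_completion G p.
have [j' [jip' jd'] jE'] := gelfand_completion G p.+1.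
have Aj y : `|A (j' y)| <= `|j' y|.
  have -> : A (j' y) = j y.
    by apply: (@hsub_incl_inj _ _ (Np p)); rewrite AE jE' jE.
  rewrite !hdot_norm /ip_norm jip jip'; exact: gelfand_increasing G p y.
apply/ler_addgt0Pl => e e0.
have C1 : 0 < C + 1 by rewrite ltr_pwDr.
(* In the factor [C + 1], the [C] pays for applying [A] to [x - j' y] and the 1 for replacing the
   norm of [j' y] by that of [x]. *)
have [_ [y _ <-] xy] := (dense_normP _).1 jd' x _ (divr_gt0 e0 C1).
rewrite -(subrK (j' y) x) linearD; apply: le_trans (ler_normD _ _) _.
rewrite subrK.
have h1 := AC (x - j' y).
have h2 : `|j' y| <= `|x - j' y| + `|x|.
  by rewrite distrC -{1}(subrK x (j' y)) ler_normD.
rewrite ltr_pdivlMr// in xy.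
have := Aj y; lra.
Qed.

Lemma gelfand_embed p : exists A : {linear Np p.+1 -> Np p},
  [/\ hilbert_schmidt A, forall x, `|A x| <= `|x| &
    forall x, hsub_incl (Np p) (A x) = hsub_incl (Np p.+1) x].
Proof.
have [A AE hsA] := gelfand_hilbert_schmidt G p; exists A; split => //.
by apply: gelfand_embed_le => //; case: hsA.
Qed.

Lemma sseq_ell2_embed p (A : {linear Np p.+1 -> Np p}) (Ac : continuous A)
    (pp : p%:Z <= p.+1%:Z) f :
  (forall x, hsub_incl (Np p) (A x) = hsub_incl (Np p.+1) x) ->
  ell2_map Ac pp (sseq_ell2 p.+1 f) = sseq_ell2 p f.
Proof.
move=> AE; apply: ell2_eq => k; apply: (@hsub_incl_inj _ _ (Np p)).
by rewrite ell2_mapE AE !sseq_ell2E.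
Qed.

Lemma sseq_norm_increasing p f : nrm p f <= nrm p.+1 f.
Proof.
have [A [[Ac _] A1 AE]] := gelfand_embed p.
have pp : p%:Z <= p.+1%:Z by rewrite lez_nat.
rewrite !sseq_normE -(sseq_ell2_embed Ac pp f AE) -[leRHS]mul1r.
by apply: norm_ell2_map => // x; rewrite mul1r.
Qed.

Lemma sseq_coord_cvg p (u : nat -> sseq Np) (g : ell2 p%:Z (Np p)) k :
  sseq_ell2 p (u n) @[n --> \oo] --> g ->
  u n k @[n --> \oo] --> hsub_incl (Np p) (g k).
Proof.
move=> /ell2_coord_cvg => /(_ k) h.
under eq_cvg do rewrite -(sseq_ell2E p).
by apply: continuous_cvg h; exact: hsub_incl_continuous.
Qed.

(** Completeness gives a limit [g] for the norm [q]. Coordinates converge in [H] for both norms, so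
    uniqueness of limits and injectivity of the inclusion force [g = 0]. *)
Lemma sseq_compatible : norms_compatible (fun p => nrm p).
Proof.
move=> p q u up uq.
have [g ug] : exists g : ell2 q%:Z (Np q), sseq_ell2 q (u n) @[n --> \oo] --> g.
  apply/cvg_ex/cauchy_seq_cvgn => e /uq[n0 h]; exists n0 => m n mn0 nn0.
  by have := h m n mn0 nn0; rewrite sseq_normE linearB.
have up0 : sseq_ell2 p (u n) @[n --> \oo] --> 0.
  by apply: norm_cvg0; under eq_cvg do rewrite -sseq_normE.
have g0 : g = 0.
  apply: ell2_eq => k; apply: (@hsub_incl_inj _ _ (Np q)).
  rewrite -(cvg_lim _ (@sseq_coord_cvg _ _ _ k ug))//.
  by rewrite (cvg_lim _ (@sseq_coord_cvg _ _ _ k up0))// !ell20 !linear0.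
rewrite g0 in ug; under eq_cvg do rewrite sseq_normE.
exact/norm_cvg0P.
Qed.

Lemma sseq_complete : norms_complete (fun p => nrm p).
Proof.
have nrm_ge0 p f : 0 <= nrm p f by rewrite sseq_normE.
move=> u /(norms_dist_cauchy nrm_ge0) uc.
have /all_sig[g ug] p :
    {h : ell2 p%:Z (Np p) | sseq_ell2 p (u n) @[n --> \oo] --> h}.
  apply: cid; apply/cvg_ex/cauchy_seq_cvgn =>
    e /(uc p)[n0 h]; exists n0 => m n mn0 nn0.
  by have := h m n mn0 nn0; rewrite sseq_normE linearB.
(* The limits [g p] live in different spaces but have the same coordinates in [H]; reading them off
   at [p = 0] gives one sequence lying in all the spaces. *)
pose x k : H := hsub_incl (Np 0%N) (g 0%N k).
have xE p k : x k = hsub_incl (Np p) (g p k).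
  rewrite /x -(cvg_lim _ (@sseq_coord_cvg _ _ _ k (ug 0%N)))//.
  by rewrite (cvg_lim _ (@sseq_coord_cvg _ _ _ k (ug p))).
have xm : x \in sseq_pred Np.
  by rewrite inE => p _; exists (g p); apply/funext => k; exact: xE.
exists (Sseq xm); apply: norms_dist_cvg => // p.
have gE : sseq_ell2 p (Sseq xm) = g p.
  apply: ell2_eq => k; apply: (@hsub_incl_inj _ _ (Np p)).
  by rewrite sseq_ell2E -xE.
have nE n : nrm p (u n - Sseq xm) = `|sseq_ell2 p (u n) - g p|.
  by rewrite sseq_normE -gE linearB.
under eq_cvg do rewrite nE distrC.
apply/norm_cvg0P.
rewrite -(subrr (g p)); apply: cvgB; [exact: cvg_cst|exact: ug].
Qed.

Lemma sseq_single_mem k (x : N) :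
  (fun n => if n == k then i x else 0) \in sseq_pred Np.
Proof.
rewrite inE => p _; have [j _ jE] := gelfand_completion G p.
exists (single p%:Z k (j x)); apply/funext => n /=.
by rewrite /single_seq; case: ifP; rewrite ?jE ?linear0.
Qed.

Definition sseq_single k x : sseq Np := Sseq (sseq_single_mem k x).

Lemma sseq_ell2_single p (j : {linear N -> Np p}) k x :
  (forall x, hsub_incl (Np p) (j x) = i x) ->
  sseq_ell2 p (sseq_single k x) = single p%:Z k (j x).
Proof.
move=> jE; apply: ell2_eq => n; apply: (@hsub_incl_inj _ _ (Np p)).
by rewrite sseq_ell2E singleE /=; case: ifP; rewrite ?jE ?linear0.
Qed.

Lemma sseq_incl_single k x : sseq_incl Np (sseq_single k x) = single 0 k (i x).
Proof. exact: ell2_eq. Qed.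

(** [N] is dense in [Np p], so finitely supported sequences with entries from [N] are dense, and
    these belong to s(N). *)
Lemma sseq_ell2_dense p : dense (range (@sseq_ell2 R H Np p)).
Proof.
have [j [_ jd] jE] := gelfand_completion G p.
apply/dense_normP => g e e0.
have [n [y [yj gy]]] := single_approx jd g e0.
have /choice[x xy] k : exists x, j x = y k by have [x _ <-] := yj k; exists x.
exists (sseq_ell2 p (\sum_(k < n) sseq_single k (x k))); first by eexists.
rewrite linear_sum (eq_bigr (fun k : 'I_n => single p%:Z k (y k)))// => k _.
by rewrite -xy; exact: sseq_ell2_single.
Qed.

Lemma ell2_incl_sseq p f : ell2_incl (Np p) p (sseq_ell2 p f) = sseq_incl Np f.
Proof. by apply: ell2_eq => k; rewrite ell2_mapE sseq_ell2E. Qed.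

Lemma ell2_incl0_dot x y :
  hdot (ell2_incl (Np 0%N) 0 x) (ell2_incl (Np 0%N) 0 y) = hdot x y.
Proof.
congr (limn (series _)); apply/funext => k.
by rewrite (gelfand_N0 G).2.
Qed.

(** Coordinatewise preimages are square summable because the inclusion of [Np 0] in [H] preserves
    norms. *)
Lemma ell2_incl0_surj : range (ell2_incl (Np 0%N) 0) = setT.
Proof.
apply/seteqP; split => // f _.
have /choice[g gf] k : exists x, hsub_incl (Np 0%N) x = f k.
  have : range (hsub_incl (Np 0%N)) (f k) by rewrite (gelfand_N0 G).1.
  by move=> [x _ <-]; exists x.
have gm : g \in ell2_pred (Np 0%N) 0.
  have /ell2_predP[M fM] := ell2_mem f; apply/ell2_predP; exists M => n.
  apply: le_trans (fM n); rewrite le_eqVlt; apply/orP; left; apply/eqP.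
  congr (series _ n); apply/funext => k.
  by rewrite -gf -!hdotxx (gelfand_N0 G).2.
exists (Ell2 gm : ell2 0%N%:Z (Np 0%N)) => //.
by apply: ell2_eq => k; rewrite ell2_mapE -gf.
Qed.

Lemma norm_sseq_incl f : `|sseq_incl Np f| = nrm 0 f.
Proof. by rewrite -(ell2_incl_sseq 0) !hdot_norm /ip_norm ell2_incl0_dot. Qed.

Lemma sseq_dual_incl h :
  topological_dual (sseq Np) (fun f => hdot h (sseq_incl Np f)).
Proof.
split=> [a f g|f A].
  by rewrite linearP hdotDr hdotZr.
move=> /nbhs_ballP[e /= e0 eA].
(* By Cauchy-Schwarz the functional is Lipschitz for the norm of index 0 with constant the norm of
   [h]; adding 1 allows division when [h = 0]. *)
have h0 : 0 < `|h| + 1 by rewrite ltr_pwDr.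
exists 0%N, (e / (`|h| + 1)); first by rewrite divr_gt0.
move=> g /(_ 0%N (leqnn _)) fg; apply: eA; rewrite -ball_normE /=.
rewrite distrC !(hdotC h) -hdotBl -linearB.
apply: le_lt_trans (hdot_le _ _) _; rewrite norm_sseq_incl.
apply: (@le_lt_trans _ _ (nrm 0 (g - f) * (`|h| + 1))).
  by rewrite ler_wpM2l ?lerDl// sseq_normE.
by rewrite -ltr_pdivlMr.
Qed.

(** Testing against sequences supported at [k] with value in [N] reduces to injectivity of the
    inclusion of [H] in [N'], after cancelling the weight. *)
Lemma sseq_dual_inj :
  injective (fun (h : ell2 0 H) f => hdot h (sseq_incl Np f)).
Proof.
move=> h h' hh; apply: ell2_eq => k; apply: (gelfand_dual_inj G).
apply/funext => x; have := congr1 (fun F => F (sseq_single k x)) hh.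
rewrite /= sseq_incl_single !hdot_single.
by apply: mulfI; rewrite gt_eqF ?ell2_weight_gt0.
Qed.

Lemma sseq_hilbert_schmidt p :
  exists2 A : {linear ell2 p.+1%:Z (Np p.+1) -> ell2 p%:Z (Np p)},
    (forall x, ell2_incl (Np p) p (A x) = ell2_incl (Np p.+1) p.+1 x) &
    hilbert_schmidt A.
Proof.
have [A [hsA _ AE]] := gelfand_embed p.
have pp : p%:Z <= p.+1%:Z by rewrite lez_nat.
exists (ell2_map hsA.1 pp).
  by move=> x; apply: ell2_eq => k; rewrite !ell2_mapE AE.
by apply: ell2_map_hilbert_schmidt => //; rewrite -PoszD addn1.
Qed.

End SseqGelfand.

Unset Implicit Arguments.

Theorem theorem2p3 (R : realType) (H : hilbertType R)
    (N : topologicalLmodType R) (N' : set (N -> R)) (i : {linear N -> H})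
    (ip : nat -> N -> N -> R) (Np : nat -> hilbert_subspace H) :
  infinite_dimensional H ->
  gelfand_spaces N' i ip Np ->
  gelfand_triple (topological_dual (sseq Np)) (sseq_incl Np) (sseq_ip Np).
Proof.
move=> _ G; exists (fun p => ell2_subspace (Np p) p); split.
- exact: ell2_separable (gelfand_separable G).
- exact: sseq_ip_inner.
(* The topology of s(N) is defined by these very norms. *)
- by [].
- exact: sseq_compatible.
- exact: sseq_norm_increasing G.
- exact: sseq_complete.
(* [sseq_ip] is the inner product pulled back along [sseq_ell2], so isometry holds by definition and
   only density needs proof. *)
- move=> p; exists (@sseq_ell2 R H Np p); last exact: ell2_incl_sseq.
  by split => //; exact: sseq_ell2_dense G p.
- split; first exact: ell2_incl0_surj G.
  exact: ell2_incl0_dot G.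
- exact: sseq_hilbert_schmidt G.
- by [].
- exact: sseq_dual_incl G.
- exact: sseq_dual_inj G.
Qed.
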